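(* Consider a two-user downlink system aided by an active STAR-RIS with $M\ge1$ elements and coupled phase-shift, with Rician fading channels and phases configured to align the signals for user $A$, and with received SNR $\gamma^B$ and diversity order $d^B$ of user $B$ as defined in the context. Then the diversity order of user $B$ is $$d^B_{\text{coupled}}=1.$$
   Context: Channels: for $m=1,\dots,M$ let $g_m$ (base station to element $m$) and $h^\chi_m$ (element $m$ to user $\chi$), $\chi\in\{A,B\}$, be mutually independent complex random variables exhibiting Rician fading, $|g_m|\sim\mathcal R(K_g,\Omega_g)$ and $|h^\chi_m|\sim\mathcal R(K^\chi_h,\Omega^\chi_h)$. Here Rician fading with shape parameter $K\ge 0$ and scale parameter $\Omega>0$ means that the channel is $\sqrt{K\Omega/(K+1)}\,e^{j\theta}+w$ with $\theta$ a deterministic phase (which may depend on the link) and $w$ a circularly symmetric complex Gaussian variable of mean $0$ and variance $\mathbb E|w|^2=\Omega/(K+1)$. SNR: with transmit power $p>0$, element noise variance $\sigma_v^2>0$, user noise variance $\sigma_B^2>0$, and element response with phase $\phi^B_m$ and amplitude $G^B_m=G^B>0$ (the same for all $m$) towards user $B$, the received SNR of user $B$ is $$\gamma^B=\frac{p\left|\sum_{m=1}^M h^B_mG^B_me^{j\phi^B_m}g_m\right|^2}{\left|\sum_{m=1}^M h^B_mG^B_me^{j\phi^B_m}\right|^2\sigma_v^2+\sigma_B^2}.$$ Phase configuration (coupled scenario): the base station and user $A$ are on side A, user $B$ is on side B. The reflection phases are aligned for user $A$ (cophase condition): $h^A_me^{j\phi^A_m}g_m=|h^A_m||g_m|$ for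 all $m$. The transmission phases serving user $B$ are then forced by the hardware coupling between the reflection coefficient $R^A_m$ and the transmission coefficient $T^{BA}_m$ of each element, namely $\phi^A_m-\phi^B_m=\pi/2$ for all $m$. Outage and diversity: for a fixed target SNR $\gamma^B_{\text{target}}>0$, the outage probability is $P^B_{out}=\Pr\{\gamma^B<\gamma^B_{\text{target}}\}$, and the diversity order is $$d^B=-\lim_{p\to\infty}\frac{\log P^B_{out}}{\log p},$$ all other parameters being fixed. *)

(* Defs.v *)
(* MathComp-Analysis, over an arbitrary R : realType; complex numbers are R[i]
   from mathcomp-real-closed. *)
From HB Require Import structures.
From mathcomp Require Export all_boot all_order all_algebra.
From mathcomp Require Export all_classical all_reals all_analysis.
From mathcomp Require Export complex.

Set Implicit Arguments.
Unset Strict Implicit.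
Unset Printing Implicit Defensive.

Export Order.TTheory GRing.Theory Num.Theory.
Export numFieldNormedType.Exports.

Open Scope classical_set_scope.
Open Scope ring_scope.
Open Scope complex_scope.

(* e^{j theta} *)
Definition cis (R : realType) (theta : R) : R[i] := cos theta +i* sin theta.

(* R[i] carries no sigma-algebra in the library: Borel sets of the complex plane
   are taken to be the measurable sets of R * R under this identification. *)
Definition re_im (R : realType) (z : R[i]) : R * R :=
  (complex.Re z, complex.Im z).

Definition complex_rv d (T : measurableType d) (R : realType) (X : T -> R[i])
  : Prop := measurable_fun [set: T] (fun t => re_im (X t)).

(* Circularly symmetric complex Gaussian with mean 0 and variance E|w|^2 = v:
   real and imaginary parts are independent centred normal variables of
   variance v / 2 (the second argument of normal_prob is the standard
   deviation). *)
Definition circular_gaussian d (T : measurableType d) (R : realType)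
    (P : probability T R) (v : R) (w : T -> R[i]) : Prop :=
  complex_rv w /\
  forall A : set (R * R), measurable A ->
    P [set t | A (re_im (w t))] =
    (normal_prob 0 (Num.sqrt (v / 2)) \x normal_prob 0 (Num.sqrt (v / 2)))%E A.

(* theta is deterministic, but each link may have its own. *)
Definition rician d (T : measurableType d) (R : realType)
    (P : probability T R) (K Omega : R) (X : T -> R[i]) : Prop :=
  exists theta : R,
    circular_gaussian P (Omega / (K + 1))
      (fun t => X t - (Num.sqrt (K * Omega / (K + 1)))%:C * cis theta).

Definition mutually_independent d (T : measurableType d) (R : realType)
    (P : probability T R) (I : finType) (X : I -> T -> R[i]) : Prop :=
  forall (J : {set I}) (B : I -> set (R * R)),
    (forall i, i \in J -> measurable (B i)) ->
    P [set t | forall i, i \in J -> B i (re_im (X i t))] =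
    (\prod_(i in J) P [set t | B i (re_im (X i t))])%E.

Definition all_links (M : nat) (U : Type) (hA hB g : 'I_M -> U)
    (l : 'I_M + 'I_M + 'I_M) : U :=
  match l with
  | inl (inl m) => hA m
  | inl (inr m) => hB m
  | inr m => g m
  end.

(* Received SNR for one channel realization: transmit power p, variances sv2
   (element noise) and su2 (user noise), element amplitudes G and phases phi. *)
Definition snr (R : realType) (M : nat) (p sv2 su2 : R) (G : 'I_M -> R)
    (h g : 'I_M -> R[i]) (phi : 'I_M -> R) : R :=
  p * ComplexField.Normc.normc
        (\sum_(m < M) h m * (G m)%:C * cis (phi m) * g m) ^+ 2 /
  (ComplexField.Normc.normc (\sum_(m < M) h m * (G m)%:C * cis (phi m)) ^+ 2
     * sv2 + su2).

Definition outage_probability d (T : measurableType d) (R : realType)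
    (P : probability T R) (gamma : T -> R) (target : R) : R :=
  fine (P [set t | gamma t < target]).

Definition diversity_ratio (R : realType) (Pout : R -> R) (p : R) : R :=
  ln (Pout p) / ln p.

(* lim is only meaningful together with convergence of diversity_ratio Pout. *)
Definition diversity_order (R : realType) (Pout : R -> R) : R :=
  - lim (diversity_ratio Pout p @[p --> +oo]).

(* Main.v *)
Require Import Defs.
From mathcomp Require Import measurable_realfun ring lra.

Set SsrOldRewriteGoalsOrder.
Set Implicit Arguments.
Unset Strict Implicit.
Unset Printing Implicit Defensive.

(* Outside the null event that some hA_m vanishes, cophasing for user A turns the
   signal received by user B into a unimodular multiple of GB * S, where
   S = \sum_m hB_m |g_m| u_m and u_m = conj(hA_m) / |hA_m|.  Conditionally on all
   the other links, S is affine in one single hB_m, a complex Gaussian whose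
   density is bounded above, and bounded below on discs.  Hence
   P(|S| < e) >= c e^2, and, cutting at the levels of the coefficient |g_m|,
   P(|S| < e) <= C e^(2 - d) for every d > 0.  The noise amplified by the surface
   is at most of order \sum_m |hB_m|, which exceeds a multiple of sqrt(ln p) with
   probability O(1/p) by the Gaussian tails; so the outage probability lies
   between c / p and C p^(-1 + d). *)

(** Some loss in the upper small ball bound is unavoidable: already for one element, |S| is a
    product of two independent Rician moduli, and P(|S| < e) is of order e^2 ln(1/e). Since a
    logarithm does not affect the diversity order, an arbitrarily small loss d in the exponent is
    accepted in its place. One [hB] is enough because all other terms only move the centre of the
    disc it has to hit, and the upper bound on its density is uniform in that centre. The amplified
    noise contains the same [hB] as S, together with phases tied to the other links, so it is never
    estimated jointly with S: off a rare event it is bounded whatever the phases are, and the factor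
    ln p that this costs is absorbed by another small power of p. Conditioning needs no conditional
    laws: the other links generate a sigma-algebra independent of the chosen [hB], so the joint law
    is a product measure and probabilities are integrals of sections. *)

Local Notation normc := ComplexField.Normc.normc.

Section MeasurableComparison.
Context d (T : measurableType d) (R : realType) (f g : T -> R).
Hypotheses (mf : measurable_fun setT f) (mg : measurable_fun setT g).

Lemma measurable_lt_set : measurable [set t | f t < g t].
Proof.
by rewrite -[X in measurable X]setTI; exact: (@measurable_fun_ltr _ _ R setT f g).
Qed.

Lemma measurable_le_set : measurable [set t | f t <= g t].
Proof.
by rewrite -[X in measurable X]setTI; exact: (@measurable_fun_ler _ _ R setT f g).
Qed.

End MeasurableComparison.

(** * Small balls and tails of Rician variables *)

Section Gaussian.
Context {R : realType}.
Implicit Types s a b x L : R.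
Notation mu := (@lebesgue_measure R).

Lemma normal_prob_itv_le s a b : s != 0 -> a <= b ->
  (normal_prob 0 s `[a, b]%classic <= (normal_peak s * (b - a))%:E)%E.
Proof.
move=> s0 ab; rewrite /normal_prob.
apply: (@le_trans _ _ (\int[mu]_(x in `[a, b]) (normal_peak s)%:E)%E).
  apply: ge0_le_integral => //=.
  - by move=> x _; rewrite lee_fin normal_pdf_ge0.
  - apply/measurable_EFinP; apply: measurable_funTS; exact: measurable_normal_pdf.
  - by move=> x _; rewrite lee_fin normal_pdf_ub.
rewrite integral_cst//= lebesgue_measure_itv/= lte_fin.
move: ab; rewrite le_eqVlt => /predU1P[->|->]; last by rewrite -EFinD -EFinM.
by rewrite ltxx mule0 subrr mulr0.
Qed.

Lemma normal_pdf_even_antitone s x L : s != 0 -> `|x| <= L ->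
  normal_pdf 0 s L <= normal_pdf 0 s x.
Proof.
move=> s0 xL; rewrite !normal_pdfE// ler_wpM2l ?normal_peak_ge0//.
rewrite /normal_fun !subr0 ler_expR !mulNr lerN2 ler_wpM2r//.
  by rewrite invr_ge0 mulrn_wge0// sqr_ge0.
rewrite -(real_normK (num_real x)) lerXn2r// nnegrE//.
exact: le_trans xL.
Qed.

Lemma normal_prob_itv_ge s L a b : s != 0 -> - L <= a -> b <= L -> a <= b ->
  ((normal_pdf 0 s L * (b - a))%:E <= normal_prob 0 s `[a, b]%classic)%E.
Proof.
move=> s0 La bL ab; rewrite /normal_prob.
apply: (@le_trans _ _ (\int[mu]_(x in `[a, b]) (normal_pdf 0 s L)%:E)%E).
  rewrite integral_cst//= lebesgue_measure_itv/= lte_fin.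
  move: ab; rewrite le_eqVlt => /predU1P[->|->]; last by rewrite -EFinD -EFinM.
  by rewrite ltxx mule0 subrr mulr0.
apply: ge0_le_integral => //=.
- by move=> x _; rewrite lee_fin normal_pdf_ge0.
- apply/measurable_EFinP; apply: measurable_funTS; exact: measurable_normal_pdf.
- move=> x; rewrite in_itv/= => /andP[ax xb].
  rewrite lee_fin normal_pdf_even_antitone// ler_norml.
  by rewrite (le_trans La ax) (le_trans xb bL).
Qed.

Lemma measurable_normr_gt L : measurable [set x : R | L < `|x|].
Proof.
exact: measurable_lt_set.
Qed.

(* On |x| > L the density is dominated by exp(-L^2/(4 s^2)) times the density of
   standard deviation sqrt 2 * s. *)
Lemma normal_prob_tail s L : s != 0 -> 0 <= L ->
  (normal_prob 0 s [set x | (L < `|x|)%R] <=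
   (normal_peak s / normal_peak (Num.sqrt 2 * s)
     * expR (- (L ^+ 2 / (4 * s ^+ 2))))%:E)%E.
Proof.
move=> s0 L0; set s' := Num.sqrt 2 * s; set c := normal_peak s / _ * _.
have s'0 : s' != 0 by rewrite mulf_neq0// sqrtr_eq0 -ltNge.
have mL := measurable_normr_gt L.
have c0 : 0 <= c.
  by rewrite mulr_ge0// ?expR_ge0// divr_ge0// normal_peak_ge0.
rewrite /normal_prob.
apply: (@le_trans _ _ (\int[mu]_(x in [set x | (L < `|x|)%R])
   (c%:E * (normal_pdf 0 s' x)%:E))%E); last first.
  rewrite ge0_integralZl//=.
  - rewrite -[leRHS]mule1 lee_pmul//=.
      by apply: integral_ge0 => x _; rewrite lee_fin normal_pdf_ge0.
    exact: (@probability_le1 _ _ R (normal_prob 0 s')).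
  - apply/measurable_EFinP; apply: measurable_funTS; exact: measurable_normal_pdf.
  - by move=> x _; rewrite lee_fin normal_pdf_ge0.
apply: ge0_le_integral => //=.
- by move=> x _; rewrite lee_fin normal_pdf_ge0.
- apply/measurable_EFinP; apply: measurable_funTS; exact: measurable_normal_pdf.
- apply/measurable_EFinP; apply: measurable_funTS.
  apply: measurable_funM => //; exact: measurable_normal_pdf.
- move=> x Lx; rewrite -EFinM lee_fin !normal_pdfE// /normal_fun !subr0.
  have B0 : 0 < normal_peak s' by rewrite normal_peak_gt0.
  rewrite /c mulrACA -mulrA mulrCA.
  rewrite mulrA (mulrC (normal_peak s')) divfK ?gt_eqF//.
  rewrite ler_wpM2l ?normal_peak_ge0// -expRD ler_expR.
  have -> : s' ^+ 2 = 2 * s ^+ 2 by rewrite exprMn sqr_sqrtr.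
  have s2 : 0 < s ^+ 2 by rewrite exprn_even_gt0.
  have Lx2 : L ^+ 2 <= x ^+ 2.
    by rewrite -[leRHS](real_normK (num_real x)) lerXn2r ?nnegrE// ltW.
  (* Half of the exponent yields the decay in [L]; the other half is the exponent of the wider
     density. *)
  have E (u y : R) : 0 < u -> - y / (u *+ 2) = - (y / (4 * u)) + - y / ((2 * u) *+ 2).
    by move=> u0; field; lra.
  rewrite (E _ _ s2).
  by rewrite lerD2r lerN2 ler_wpM2r// invr_ge0 mulr_ge0// ltW.
Qed.

End Gaussian.

(** * Moduli and measurability of complex random variables *)

Section Normc.
Context {R : realType}.
Implicit Types z w : R[i].

Lemma normc_ge0 z : 0 <= normc z.
Proof. by case: z => a b; exact: sqrtr_ge0. Qed.

Lemma normcD z w : normc (z + w) <= normc z + normc w.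
Proof. exact: le_normcD. Qed.

Lemma normc_Re z : `|complex.Re z| <= normc z.
Proof.
by case: z => a b /=; rewrite -sqrtr_sqr ler_wsqrtr// lerDl sqr_ge0.
Qed.

Lemma normc_Im z : `|complex.Im z| <= normc z.
Proof.
by case: z => a b /=; rewrite -sqrtr_sqr ler_wsqrtr// lerDr sqr_ge0.
Qed.

Lemma normc_le z : normc z <= `|complex.Re z| + `|complex.Im z|.
Proof.
case: z => a b /=; rewrite -[leRHS]ger0_norm ?addr_ge0// -sqrtr_sqr ler_wsqrtr//.
by rewrite sqrrD !real_normK ?num_real// lerD2r lerDl mulrn_wge0 ?mulr_ge0.
Qed.

End Normc.

Section ComplexRv.
Context d (T : measurableType d) (R : realType).
Implicit Types X Y : T -> R[i].

Lemma complex_rvP X : complex_rv X <->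
  measurable_fun setT (fun t => complex.Re (X t)) /\
  measurable_fun setT (fun t => complex.Im (X t)).
Proof. exact: measurable_fun_pairP. Qed.

Lemma complex_rv_cst z : complex_rv (fun _ : T => z : R[i]).
Proof. by apply/complex_rvP; split; exact: measurable_cst. Qed.

Lemma complex_rv_real (f : T -> R) :
  measurable_fun setT f -> complex_rv (fun t => (f t)%:C).
Proof. by move=> mf; apply/complex_rvP; split => //; exact: measurable_cst. Qed.

Lemma complex_rvD X Y :
  complex_rv X -> complex_rv Y -> complex_rv (fun t => X t + Y t).
Proof.
move=> /complex_rvP[X1 X2] /complex_rvP[Y1 Y2]; apply/complex_rvP; split.
  under eq_fun => t do rewrite raddfD/=; exact: measurable_funD.
under eq_fun => t do rewrite raddfD/=; exact: measurable_funD.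
Qed.

Lemma complex_rvM X Y :
  complex_rv X -> complex_rv Y -> complex_rv (fun t => X t * Y t).
Proof.
move=> /complex_rvP[X1 X2] /complex_rvP[Y1 Y2]; apply/complex_rvP; split.
  rewrite (_ : (fun _ => _) = fun t => complex.Re (X t) * complex.Re (Y t) -
      complex.Im (X t) * complex.Im (Y t)).
    by apply: measurable_funB; apply: measurable_funM.
  by apply/funext => t; case: (X t) (Y t) => [a b] [c e].
rewrite (_ : (fun _ => _) = fun t => complex.Re (X t) * complex.Im (Y t) +
    complex.Im (X t) * complex.Re (Y t)).
  by apply: measurable_funD; apply: measurable_funM.
by apply/funext => t; case: (X t) (Y t) => [a b] [c e].
Qed.

Lemma complex_rv_sum (I : Type) (s : seq I) (Q : pred I) (X : I -> T -> R[i]) :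
  (forall i, Q i -> complex_rv (X i)) ->
  complex_rv (fun t => \sum_(i <- s | Q i) X i t).
Proof.
move=> mX; elim: s => [|i s IH].
  by under eq_fun => t do rewrite big_nil; exact: complex_rv_cst.
have [Qi|/negbTE Qi] := boolP (Q i).
  by under eq_fun => t do rewrite big_cons Qi; apply: complex_rvD => //; exact: mX.
by under eq_fun => t do rewrite big_cons Qi.
Qed.

Lemma complex_rv_cis (f : T -> R) :
  measurable_fun setT f -> complex_rv (fun t => cis (f t)).
Proof.
move=> mf; apply/complex_rvP; split => /=.
  by apply: measurableT_comp => //; apply: continuous_measurable_fun; exact: continuous_cos.
by apply: measurableT_comp => //; apply: continuous_measurable_fun; exact: continuous_sin.
Qed.

Lemma complex_rv_conj X : complex_rv X -> complex_rv (fun t => (X t)^*%C).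
Proof.
move=> /complex_rvP[X1 X2]; apply/complex_rvP; split.
  by rewrite (_ : (fun _ => _) = fun t => complex.Re (X t))//; apply/funext => t; case: (X t).
rewrite (_ : (fun _ => _) = fun t => - complex.Im (X t)).
  exact: measurableT_comp.
by apply/funext => t; case: (X t).
Qed.

Lemma measurable_normc X : complex_rv X -> measurable_fun setT (fun t => normc (X t)).
Proof.
move=> /complex_rvP[X1 X2].
rewrite (_ : (fun _ => _) = fun t => Num.sqrt (complex.Re (X t) ^+ 2 + complex.Im (X t) ^+ 2)).
  apply: measurableT_comp => //.
    by apply: continuous_measurable_fun; exact: sqrt_continuous.
  by apply: measurable_funD; apply: measurable_funX.
by apply/funext => t; case: (X t).
Qed.

Lemma measurable_normc_le X (s : R) : complex_rv X -> measurable [set t | normc (X t) <= s].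
Proof. by move=> mX; apply: measurable_le_set => //; exact: measurable_normc. Qed.

Lemma measurable_normc_lt X (s : R) : complex_rv X -> measurable [set t | normc (X t) < s].
Proof. by move=> mX; apply: measurable_lt_set => //; exact: measurable_normc. Qed.

Lemma complex_rv_phase X : complex_rv X ->
  complex_rv (fun t => (X t)^*%C * ((normc (X t))^-1)%:C).
Proof.
move=> mX; apply: complex_rvM; first exact: complex_rv_conj.
apply: complex_rv_real.
(* The power with exponent -1 is measurable everywhere and agrees with the inverse on nonnegative
   reals, including 0, where both are 0. *)
rewrite (_ : (fun _ => _) = fun t => normc (X t) `^ (-1)).
  apply: (measurableT_comp (f := fun x : R => x `^ (-1))); last exact: measurable_normc.
  exact: measurable_powR.
by apply/funext => t; rewrite powR_inv1// normc_ge0.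
Qed.
End ComplexRv.

(** * Boxes, discs and tails of a Rician variable *)

Section Rician.
Context d (T : measurableType d) (R : realType) (P : probability T R).
Variables (K Om : R) (X : T -> R[i]).
Hypotheses (K0 : 0 <= K) (Om0 : 0 < Om) (XP : rician P K Om X).

(** Removing the deterministic component leaves two independent centred normal variables. [m1] and
    [m2] are the parts of that component; they depend on the phase of the link, but the bound [c]
    does not, which is what later makes the tail constants common to all elements. *)
Lemma rician_box : let s := Num.sqrt (Om / (K + 1) / 2) in
  let c := Num.sqrt (K * Om / (K + 1)) in
  exists m1 m2 : R, 0 < s /\ `|m1| <= c /\ `|m2| <= c /\ complex_rv X /\
  forall A B : set R, measurable A -> measurable B ->
  P [set t | A (complex.Re (X t) - m1) /\ B (complex.Im (X t) - m2)] =
  (normal_prob 0 s A * normal_prob 0 s B)%E.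
Proof.
case: XP => theta [mw Pw] s c; set z := (X in X * cis _) in mw Pw.
exists (complex.Re (z * cis theta)), (complex.Im (z * cis theta)); split.
  by rewrite sqrtr_gt0 !divr_gt0// ltr_wpDl.
have zc : normc (z * cis theta) = c.
  rewrite ComplexField.Normc.normcM /cis /= cos2Dsin2 sqrtr1 mulr1.
  by rewrite expr0n/= addr0 sqrtr_sqr ger0_norm ?sqrtr_ge0.
split; first by rewrite -zc normc_Re.
split; first by rewrite -zc normc_Im.
split.
  have := complex_rvD mw (@complex_rv_cst _ T R (z * cis theta)).
  by congr complex_rv; apply/funext => t; rewrite subrK.
move=> A B mA mB; rewrite -product_measure1E// -Pw; last exact: measurableX.
by congr (P _); apply/seteqP; split => t /=; rewrite !raddfB.
Qed.

Lemma rician_rv : complex_rv X.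
Proof. by have [m1 [m2 [? [? [? []]]]]] := rician_box. Qed.

Lemma measurable_rician_disc z rho :
  measurable [set t | normc (X t - z) <= rho].
Proof.
apply: measurable_normc_le; apply: complex_rvD; first exact: rician_rv.
exact: complex_rv_cst.
Qed.

(** The disc lies in a square of side [2 * rho], and each side has normal probability at most its
    length times the peak. Uniformity in [z] is essential: after conditioning, the centre is an
    arbitrary value of the other links. *)
Lemma rician_disc_le : exists2 C : R, 0 <= C & forall z rho, 0 <= rho ->
  (P [set t | (normc (X t - z) <= rho)%R] <= (C * rho ^+ 2)%:E)%E.
Proof.
have [m1 [m2 []]] := rician_box; set s := Num.sqrt _ => s0 [_ [_ [mX Pbox]]].
have sn0 : s != 0 by rewrite gt_eqF.
exists ((2 * normal_peak s) ^+ 2); first exact: sqr_ge0.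
move=> z rho rho0.
pose I (c : R) := `[c - rho, c + rho]%classic.
have mI c : measurable (I c) by exact: measurable_itv.
have Ile (c : R) : (normal_prob 0 s (I c) <= (2 * normal_peak s * rho)%:E)%E.
  apply: le_trans (normal_prob_itv_le sn0 _) _; first lra.
  by rewrite lee_fin le_eqVlt; apply/orP; left; apply/eqP; ring.
apply: (@le_trans _ _ (P [set t | I (complex.Re z - m1)%R (complex.Re (X t) - m1)%R /\
   I (complex.Im z - m2)%R (complex.Im (X t) - m2)%R])).
  apply: le_measure; rewrite ?inE; first exact: measurable_rician_disc.
    have /complex_rvP[mX1 mX2] := mX.
    rewrite (_ : [set t | _] = (fun t => complex.Re (X t) - m1) @^-1` I (complex.Re z - m1) `&`
      (fun t => complex.Im (X t) - m2) @^-1` I (complex.Im z - m2))//.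
    by apply: measurableI; rewrite -[X in measurable X]setTI;
       apply: measurable_funB => //; exact: measurable_itv.
  move=> t /= H.
  have := le_trans (normc_Re (X t - z)) H; have := le_trans (normc_Im (X t - z)) H.
  rewrite !raddfB/= !ler_norml /I/= !in_itv/= => /andP[? ?] /andP[? ?].
  by split; apply/andP; split; lra.
rewrite Pbox//.
apply: le_trans (lee_pmul _ _ (Ile _) (Ile _)) _ => //.
by rewrite -EFinM lee_fin -exprMn -expr2.
Qed.

(** The density is bounded below only on bounded sets, hence the bound [L] on the centre. The disc
    contains the square of half-side [rho / 4], for which the sum of the two coordinates is at most
    [rho / 2 < rho]. *)
Lemma rician_disc_ge L : exists2 c : R, 0 < c & forall z rho, normc z <= L ->
  0 < rho <= 1 -> ((c * rho ^+ 2)%:E <= P [set t | (normc (X t - z) < rho)%R])%E.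
Proof.
have [m1 [m2 []]] := rician_box; set s := Num.sqrt _ => s0 [_ [_ [mX Pbox]]].
have sn0 : s != 0 by rewrite gt_eqF.
(* Large enough for the sides of the square, recentred at [m1] and [m2], to stay in [-L', L'] when
   [rho <= 1]. *)
pose L' := L + 1 + `|m1| + `|m2|.
have pdf0 : 0 < normal_pdf 0 s L'.
  by rewrite normal_pdfE// mulr_gt0 ?expR_gt0// normal_peak_gt0.
exists ((normal_pdf 0 s L' / 2) ^+ 2); first by rewrite exprn_gt0// divr_gt0.
move=> z rho zL /andP[rho0 rho1].
pose I (c : R) := `[c - rho / 4, c + rho / 4]%classic.
have mI c : measurable (I c) by exact: measurable_itv.
have Ige (c : R) : `|c| <= L' - 1 -> ((normal_pdf 0 s L' / 2 * rho)%:E <= normal_prob 0 s (I c))%E.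
  rewrite ler_norml => /andP[cL Lc].
  apply: le_trans (normal_prob_itv_ge (L := L') sn0 _ _ _); [|lra..].
  by rewrite lee_fin le_eqVlt; apply/orP; left; apply/eqP; field.
apply: (@le_trans _ _ (P [set t | I (complex.Re z - m1)%R (complex.Re (X t) - m1)%R /\
   I (complex.Im z - m2)%R (complex.Im (X t) - m2)%R])); last first.
  apply: le_measure; rewrite ?inE.
  - have /complex_rvP[mX1 mX2] := mX.
    rewrite (_ : [set t | _] = (fun t => complex.Re (X t) - m1) @^-1` I (complex.Re z - m1) `&`
      (fun t => complex.Im (X t) - m2) @^-1` I (complex.Im z - m2))//.
    by apply: measurableI; rewrite -[X in measurable X]setTI;
       apply: measurable_funB => //; exact: measurable_itv.
  - by apply: measurable_normc_lt; apply: complex_rvD => //; exact: complex_rv_cst.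
  - move=> t /=; rewrite /I/= !in_itv/= => -[/andP[? ?] /andP[? ?]].
    apply: le_lt_trans (normc_le _) _; rewrite !raddfB/=.
    apply: (@le_lt_trans _ _ (rho / 4 + rho / 4)); last lra.
    by apply: lerD; rewrite ler_norml; apply/andP; split; lra.
have Rez : `|complex.Re z| <= L := le_trans (normc_Re z) zL.
have Imz : `|complex.Im z| <= L := le_trans (normc_Im z) zL.
have m10 : 0 <= `|m1| := normr_ge0 _.
have m20 : 0 <= `|m2| := normr_ge0 _.
rewrite Pbox//.
rewrite -exprMn expr2 EFinM.
apply: lee_pmul; rewrite ?lee_fin ?mulr_ge0 ?invr_ge0 ?(ltW pdf0) ?(ltW rho0)//.
  by apply: Ige; apply: le_trans (ler_normB _ _) _; rewrite /L'; lra.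
by apply: Ige; apply: le_trans (ler_normB _ _) _; rewrite /L'; lra.
Qed.

End Rician.

Lemma rician_tail d (T : measurableType d) (R : realType) (P : probability T R)
  (K Om : R) : 0 <= K -> 0 < Om -> exists C k L0 : R, 0 <= C /\ 0 < k /\
  forall (X : T -> R[i]) L, rician P K Om X -> L0 <= L ->
  (P [set t | (L < normc (X t))%R] <= (C * expR (- (k * L ^+ 2)))%:E)%E.
Proof.
move=> K0 Om0; pose s := Num.sqrt (Om / (K + 1) / 2).
have s0 : 0 < s by rewrite sqrtr_gt0 !divr_gt0// ltr_wpDl.
have sn0 : s != 0 by rewrite gt_eqF.
pose c := Num.sqrt (K * Om / (K + 1)).
have c0 : 0 <= c := sqrtr_ge0 _.
set C := normal_peak s / normal_peak (Num.sqrt 2 * s).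
have C0 : 0 <= C by rewrite divr_ge0// normal_peak_ge0.
(* If [L >= 8 * c], the deterministic parts add up to at most [L / 4], so a modulus above [L] forces
   one of the two centred parts above [L / 4]. The factor 2 is the union bound, and 64 is 4 times
   the square of 4. *)
exists (2 * C), (64 * s ^+ 2)^-1, (8 * c); split; first lra.
split; first by rewrite invr_gt0 mulr_gt0// exprn_gt0.
move=> X L XP LL0.
have [m1 [m2 [_ [m1c [m2c [mX Pbox]]]]]] := rician_box K0 Om0 XP.
rewrite -/s in Pbox; rewrite -/c in m1c m2c.
have L0 : 0 <= L / 4 by lra.
pose V : set R := [set x | L / 4 < `|x|].
have mV : measurable V by exact: measurable_normr_gt.
have V1 : (normal_prob 0 s V <= (C * expR (- ((64 * s ^+ 2)^-1 * L ^+ 2)))%:E)%E.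
  apply: le_trans (normal_prob_tail sn0 L0) _; rewrite lee_fin ler_wpM2l// ler_expR.
  by rewrite le_eqVlt; apply/orP; left; apply/eqP; field.
have /complex_rvP[mX1 mX2] := mX.
have PA : P [set t | V (complex.Re (X t) - m1)] = normal_prob 0 s V.
  rewrite -[RHS]mule1 -(@probability_setT _ _ R (normal_prob 0 s)) -Pbox//.
  by congr (P _); apply/seteqP; split => t //= [].
have PB : P [set t | V (complex.Im (X t) - m2)] = normal_prob 0 s V.
  rewrite -[RHS]mul1e -(@probability_setT _ _ R (normal_prob 0 s)) -Pbox//.
  by congr (P _); apply/seteqP; split => t //= [].
have mA : measurable [set t | V (complex.Re (X t) - m1)].
  by rewrite -[X in measurable X]setTI; apply: measurable_funB.
have mB : measurable [set t | V (complex.Im (X t) - m2)].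
  by rewrite -[X in measurable X]setTI; apply: measurable_funB.
apply: (@le_trans _ _ (P ([set t | V (complex.Re (X t) - m1)] `|`
    [set t | V (complex.Im (X t) - m2)]))).
  apply: le_measure; rewrite ?inE.
  - by apply: measurable_lt_set => //; exact: measurable_normc.
  - exact: measurableU.
  - move=> t /= Lt; apply/orP; rewrite /V/= -[_ || _]negbK negb_or -!leNgt.
    apply/negP => /andP[h1 h2].
    have := lt_le_trans Lt (normc_le _).
    have h3 := ler_normD (complex.Re (X t) - m1) m1.
    have h4 := ler_normD (complex.Im (X t) - m2) m2.
    rewrite !subrK in h3 h4; lra.
apply: (@le_trans _ _ (normal_prob 0 s V + normal_prob 0 s V)%E).
  by rewrite -{1}PA -PB; exact: measureU2.
apply: le_trans (leeD V1 V1) _.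
by rewrite -EFinD lee_fin; lra.
Qed.

(** * Conditioning on the other links *)

Section Independence.
Context d (T : measurableType d) (R : realType) (P : probability T R).
Variables (I : finType) (X : I -> T -> R[i]) (i0 : I).
Hypotheses (mX : forall i, complex_rv (X i)) (indepX : mutually_independent P X).

(* Cylinder events not involving X i0: a pi-system generating the joint
   sigma-algebra of the other variables. *)
Definition other_cylinders : set (set T) :=
  [set C | exists2 B : I -> set (R * R), (forall i, measurable (B i)) &
    C = [set t | forall i, i != i0 -> B i (re_im (X i t))]].

Lemma other_cylinders_setI : setI_closed other_cylinders.
Proof.
move=> _ _ [B mB ->] [C mC ->]; exists (fun i => B i `&` C i).
  by move=> i; exact: measurableI.
apply/seteqP; split => t /=.
  by move=> [tB tC] i ii0; split; [exact: tB|exact: tC].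
by move=> tBC; split => i /tBC[].
Qed.

Lemma measurable_preimage_re_im i (B : set (R * R)) : measurable B ->
  measurable [set t | B (re_im (X i t))].
Proof. by move=> mB; rewrite -[X in measurable X]setTI; exact: mX. Qed.

Lemma measurable_other_cylinders : other_cylinders `<=` measurable.
Proof.
move=> _ [B mB ->].
apply: (@fin_bigcap_measurable _ T I [set i | i != i0]
  (fun i => [set t | B i (re_im (X i t))])); first exact: finite_finset.
by move=> i _; exact: measurable_preimage_re_im.
Qed.

(** With the event on [X i0] fixed, both sides are finite measures in [C]. They agree on the
    cylinders by mutual independence, hence on the sigma-algebra these generate. *)
Lemma indep_sigma_other (A : set (R * R)) (C : set T) : measurable A ->
  <<s other_cylinders >> C ->
  P ([set t | A (re_im (X i0 t))] `&` C) = (P [set t | A (re_im (X i0 t))] * P C)%E.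
Proof.
move=> mA.
set D := [set t | _]; have mD : measurable D by exact: measurable_preimage_re_im.
have finPD : fine (P D) >= 0 by rewrite fine_ge0.
pose m2 := mscale (NngNum finPD) P.
have -> : P (D `&` C) = mrestr P mD C by rewrite /mrestr setIC.
have -> : (P D * P C)%E = m2 C by rewrite /m2 /mscale/= fineK// fin_num_measure.
apply: (@g_sigma_algebra_measure_unique _ R T other_cylinders
  measurable_other_cylinders (fun=> setT)).
- by move=> _; exists (fun=> setT) => //; apply/seteqP; split.
- by rewrite bigcup_const.
- exact: other_cylinders_setI.
- move=> _ [B mB ->]; rewrite /mrestr/= /m2 /mscale/= fineK ?fin_num_measure//.
  (* Putting [A] in the slot [i0] turns the intersection into a cylinder over all indices; the
     second factor is the cylinder over the complement of [i0]. *)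
  pose B' i := if i == i0 then A else B i.
  have mB' i : i \in [set: I]%SET -> measurable (B' i).
    by rewrite /B'; case: ifPn.
  have /(_ (fun i _ => mB i)) e2 := indepX (J := [set~ i0]%SET) (B := B).
  have := indepX (J := [set: I]%SET) mB'.
  rewrite (bigD1 i0)//= {2}/B' eqxx.
  rewrite (_ : [set t | _] = [set t | forall i, i != i0 -> B i (re_im (X i t))] `&` D).
    rewrite /mrestr => ->; congr (_ * _)%E.
    rewrite (_ : [set t | forall i, i != i0 -> _] =
        [set t | forall i, i \in [set~ i0]%SET -> B i (re_im (X i t))]).
      rewrite e2; apply: eq_big => [i|i]; first by rewrite !inE.
      by rewrite /B' => /andP[_ /negbTE ->].
    by apply/seteqP; split => t /= h i ii0; apply: h; move: ii0; rewrite !inE.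
  apply/seteqP; split => t /=.
    move=> h; split => [i ii0|]; first by have := h i (finset.in_setT _); rewrite /B' (negbTE ii0).
    by have := h i0 (finset.in_setT _); rewrite /B' eqxx.
  move=> [h Dt] i _; rewrite /B'; case: eqVneq => [->//|]; exact: h.
- move=> _; exact: (le_lt_trans (probability_le1 P (measurableI _ _ measurableT mD)) (ltry _)).
Qed.
End Independence.

Section Conditioning.
Context d d1 d2 (T : measurableType d) (U : measurableType d1)
  (V : measurableType d2) (R : realType) (P : probability T R).
Variables (Y : T -> U) (Z : T -> V).
Hypotheses (mY : measurable_fun setT Y) (mZ : measurable_fun setT Z).
Hypothesis indepYZ : forall A B, measurable A -> measurable B ->
  P [set t | A (Y t) /\ B (Z t)] = (P [set t | A (Y t)] * P [set t | B (Z t)])%E.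

Let Y' : {mfun T >-> U} := mfun_Sub (mem_set mY).
Let Z' : {mfun T >-> V} := mfun_Sub (mem_set mZ).

(** Independence identifies the law of the pair with the product of the marginal laws, and a product
    measure integrates the measures of sections. *)
Lemma indep_integral_xsection (E : set (U * V)) : measurable E ->
  P [set t | E (Y t, Z t)] =
  (\int[distribution P Y']_y P [set t | E (y, Z t)])%E.
Proof.
move=> mE.
pose W' : {mfun T >-> (U * V)%type} := mfun_Sub (mem_set (measurable_fun_pair mY mZ)).
transitivity (distribution P W' E); first by [].
rewrite -(@product_measure_unique _ _ U V R (distribution P Y') (distribution P Z')) //.
by apply: eq_integral => y _ /=; congr (P _); apply/seteqP; split => t /=; rewrite /xsection/= ?inE.
Qed.

(** The factor P(Y in F) is kept on the right because the small probability of each level of the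
    coefficient must compensate for the worse conditional bound there. *)
Lemma indep_prob_le (E : set (U * V)) (F : set U) (c : R) :
  measurable E -> measurable F -> 0 <= c ->
  (forall y, F y -> (P [set t | E (y, Z t)] <= c%:E)%E) ->
  (P [set t | E (Y t, Z t) /\ F (Y t)] <= c%:E * P [set t | F (Y t)])%E.
Proof.
move=> mE mF c0 EF.
have mEF : measurable (E `&` (F `*` setT)).
  by apply: measurableI => //; exact: measurableX.
rewrite (_ : [set t | _ /\ _] = [set t | (E `&` (F `*` setT)) (Y t, Z t)]); last first.
  by apply/seteqP; split => t /= [? ?]; [split|split; tauto].
rewrite indep_integral_xsection//.
apply: (@le_trans _ _ (\int[distribution P Y']_y (c%:E * (\1_F y)%:E))%E).
  apply: ge0_le_integral => //=.
  - have := measurable_fun_xsection (distribution P Z') mEF.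
    congr measurable_fun; apply/funext => y /=; congr (P _).
    by apply/seteqP; split => t /=; rewrite /xsection/= ?inE.
  - by apply: measurable_funeM; apply/measurable_EFinP; exact: measurable_indic.
  - move=> y _; rewrite indicE; have [yF|yF] := boolP (y \in F).
      rewrite mule1; apply: le_trans (EF y _); last by rewrite -in_setE.
      rewrite le_eqVlt; apply/orP; left; apply/eqP; congr (P _).
      by apply/seteqP; split => t /= => [[]//|Ey]; split => //; split => //; rewrite -in_setE.
    rewrite mule0 (_ : [set t | _] = set0) ?measure0//.
    apply/seteqP; split => t //= [_ [Fy _]]; move: yF; rewrite notin_setE; exact.
rewrite ge0_integralZl//=.
- by rewrite integral_indic// setIT.
- by apply/measurable_EFinP; exact: measurable_indic.
Qed.

Lemma indep_prob_ge (E : set (U * V)) (F : set U) (c : R) :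
  measurable E -> measurable F -> 0 <= c ->
  (forall y, F y -> (c%:E <= P [set t | E (y, Z t)])%E) ->
  (c%:E * P [set t | F (Y t)] <= P [set t | E (Y t, Z t)])%E.
Proof.
move=> mE mF c0 EF.
rewrite indep_integral_xsection//.
apply: (@le_trans _ _ (\int[distribution P Y']_y (c%:E * (\1_F y)%:E))%E).
  rewrite ge0_integralZl//=.
  - by rewrite integral_indic// setIT.
  - by apply/measurable_EFinP; exact: measurable_indic.
apply: ge0_le_integral => //=.
- by move=> y _; rewrite mule_ge0// lee_fin.
- by apply: measurable_funeM; apply/measurable_EFinP; exact: measurable_indic.
- have := measurable_fun_xsection (distribution P Z') mE.
  congr measurable_fun; apply/funext => y /=; congr (P _).
  by apply/seteqP; split => t /=; rewrite /xsection/= ?inE.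
- move=> y _; rewrite indicE; have [yF|yF] := boolP (y \in F).
    by rewrite mule1; apply: EF; rewrite -in_setE.
  by rewrite mule0.
Qed.

End Conditioning.

Definition cplx (R : realType) (p : R * R) : R[i] := p.1 +i* p.2.
Arguments cplx : simpl never.

Lemma re_imK (R : realType) (z : R[i]) : cplx (re_im z) = z.
Proof. by case: z. Qed.

(** * Small balls of [b * w + r] with [b] independent of the pair [(w, r)] *)

Section AffineSmallBall.
Context d (T : measurableType d) (R : realType) (P : probability T R).
Variables (b w r : T -> R[i]).
Hypotheses (mb : complex_rv b) (mw : complex_rv w) (mr : complex_rv r).
Hypothesis indep_b : forall (A : set ((R * R) * (R * R))) (B : set (R * R)),
  measurable A -> measurable B ->
  P [set t | A (re_im (w t), re_im (r t)) /\ B (re_im (b t))] =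
  (P [set t | A (re_im (w t), re_im (r t))] * P [set t | B (re_im (b t))])%E.


Let rv_cplx {d'} (U : measurableType d') (f : U -> R * R) :
  measurable_fun setT f -> complex_rv (fun u => cplx (f u)).
Proof.
move=> mf; apply/complex_rvP; split => /=.
  exact: (measurableT_comp (@measurable_fst _ _ R R)).
exact: (measurableT_comp (@measurable_snd _ _ R R)).
Qed.

Let E (eps : R) : set (((R * R) * (R * R)) * (R * R)) :=
  [set p | normc (cplx p.2 * cplx p.1.1 + cplx p.1.2) < eps].

Let mfst12 : measurable_fun setT (fun p : ((R * R) * (R * R)) * (R * R) => p.1.1).
Proof. by apply: (measurableT_comp measurable_fst); exact: measurable_fst. Qed.

Let msnd12 : measurable_fun setT (fun p : ((R * R) * (R * R)) * (R * R) => p.1.2).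
Proof. by apply: (measurableT_comp measurable_snd); exact: measurable_fst. Qed.

Let mE eps : measurable (E eps).
Proof.
apply: measurable_normc_lt; apply: complex_rvD; last exact: rv_cplx.
by apply: complex_rvM; apply: rv_cplx => //; exact: measurable_snd.
Qed.

Let mnw : measurable_fun setT (fun y : (R * R) * (R * R) => normc (cplx y.1)).
Proof. by apply: measurable_normc; apply: rv_cplx; exact: measurable_fst. Qed.

Let mnr : measurable_fun setT (fun y : (R * R) * (R * R) => normc (cplx y.2)).
Proof. by apply: measurable_normc; apply: rv_cplx; exact: measurable_snd. Qed.

Let affine_normc (x y z : R[i]) : y != 0 ->
  normc (x - - z / y) = normc (x * y + z) / normc y.
Proof.
move=> y0; have -> : x - - z / y = (x * y + z) / y by field.
by rewrite ComplexField.Normc.normcM ComplexField.Normc.normcV.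
Qed.

Let E_re_im eps (z1 z2 z3 : R[i]) :
  E eps ((re_im z1, re_im z2), re_im z3) = (normc (z3 * z1 + z2) < eps) :> Prop.
Proof. by case: z1 z2 z3 => [? ?] [? ?] [? ?]. Qed.

Let E_cplx eps (y : (R * R) * (R * R)) (z : R[i]) :
  E eps (y, re_im z) = (normc (z * cplx y.1 + cplx y.2) < eps) :> Prop.
Proof. by case: z => [? ?]. Qed.

(** Once [w] and [r] are fixed, the event puts [b] in the disc of centre [- r / w] and radius
    [eps / |w|], which is at most [eps / rho] under [Q]. *)
Lemma affine_small_ball_le_cond (C eps rho : R) (Q : R[i] -> Prop) :
  0 <= C -> 0 < rho -> 0 <= eps ->
  measurable [set y : (R * R) * (R * R) | Q (cplx y.1)] ->
  (forall z s, 0 <= s -> (P [set t | (normc (b t - z) <= s)%R] <= (C * s ^+ 2)%:E)%E) ->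
  (forall y, Q y -> rho <= normc y) ->
  (P [set t | (normc (b t * w t + r t) < eps)%R /\ Q (w t)] <=
   (C * (eps / rho) ^+ 2)%:E * P [set t | Q (w t)])%E.
Proof.
move=> C0 rho0 eps0 mF bub Qrho; set F := [set y | _] in mF.
have := @indep_prob_le _ _ _ T _ _ R P (fun t => (re_im (w t), re_im (r t))) (fun t => re_im (b t))
  (measurable_fun_pair mw mr) mb indep_b (E eps) F (C * (eps / rho) ^+ 2) (mE eps) mF.
have FQ t : F (re_im (w t), re_im (r t)) = Q (w t) by rewrite /F/= re_imK.
have -> : [set t | F (re_im (w t), re_im (r t))] = [set t | Q (w t)] by apply/funext.
have -> : [set t | E eps ((re_im (w t), re_im (r t)), re_im (b t)) /\
      F (re_im (w t), re_im (r t))] =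
    [set t | normc (b t * w t + r t) < eps /\ Q (w t)].
  by apply/funext => t; rewrite /mkset E_re_im FQ.
apply; first by rewrite mulr_ge0 ?sqr_ge0.
move=> [y1 y2] /Qrho/= rhoy; set y := cplx y1 in rhoy *; set z := cplx y2.
have y0 : 0 < normc y by exact: lt_le_trans rhoy.
have yn0 : y != 0 by apply: contraTneq y0 => ->; rewrite ComplexField.Normc.normc0 ltxx.
under eq_set => t do rewrite E_cplx.
rewrite -/y -/z; apply: le_trans (bub (- z / y) (eps / rho) _); last by rewrite divr_ge0// ltW.
apply: le_measure; rewrite ?inE.
- apply: measurable_lt_set => //; apply: measurable_normc.
  apply: complex_rvD; last exact: complex_rv_cst.
  by apply: complex_rvM => //; exact: complex_rv_cst.
- apply: measurable_le_set => //; apply: measurable_normc.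
  by apply: complex_rvD => //; exact: complex_rv_cst.
- move=> t /= lte; rewrite affine_normc//.
  by rewrite ler_pM ?normc_ge0 ?invr_ge0 ?normc_ge0 ?(ltW lte)// lef_pV2.
Qed.

(* The levels q^(k+1) <= |w| < q^k, k <= m, each contribute at most C D q^(2m); taking
   m large and q^(m+1) = e, the exponent of e gets close to 2. *)
Lemma affine_small_ball_le (C D q : R) (m : nat) : 0 <= C -> 0 <= D -> 0 < q < 1 ->
  (forall z s, 0 <= s -> (P [set t | (normc (b t - z) <= s)%R] <= (C * s ^+ 2)%:E)%E) ->
  (forall s, 0 <= s -> (P [set t | (normc (w t) <= s)%R] <= (D * s ^+ 2)%:E)%E) ->
  (P [set t | (normc (b t * w t + r t) < q ^+ m.+1)%R] <=
   ((C + D + m.+1%:R * (C * D)) * q ^+ m ^+ 2)%:E)%E.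
Proof.
move=> C0 D0 /andP[q0 q1] bub wub.
have qn0 k : 0 < q ^+ k by exact: exprn_gt0.
set eps := q ^+ m.+1.
have eps0 : 0 <= eps by rewrite ltW// qn0.
have epsq : eps ^+ 2 <= q ^+ m ^+ 2.
  rewrite lerXn2r ?nnegrE ?(ltW (qn0 m))//.
  by rewrite /eps exprS ger_pMl ?qn0// ltW.
pose S := [set t | normc (b t * w t + r t) < eps].
pose W s := [set t | normc (w t) < s].
pose V s s' := [set t | s <= normc (w t) /\ normc (w t) < s'].
have mnw' := measurable_normc mw.
have mS : measurable S.
  by apply: measurable_normc_lt; apply: complex_rvD => //; exact: complex_rvM.
have mW s : measurable (W s) by apply: measurable_lt_set.
have Wub s : 0 <= s -> (P (W s) <= (D * s ^+ 2)%:E)%E.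
  move=> s0; apply: le_trans (wub _ s0); apply: le_measure; rewrite ?inE//.
    by apply: measurable_le_set.
  by move=> t /=; exact: ltW.
have mV s s' : measurable (V s s').
  rewrite (_ : V s s' = [set t | s <= normc (w t)] `&` W s')//.
  by apply: measurableI => //; apply: measurable_le_set.
have layer k : (P (S `&` V (q ^+ k.+1)%R (q ^+ k)%R) <= (C * D * q ^+ m ^+ 2)%:E)%E.
  pose Q (z : R[i]) := q ^+ k.+1 <= normc z /\ normc z < q ^+ k.
  have mF : measurable [set y : (R * R) * (R * R) |
      q ^+ k.+1 <= normc (cplx y.1) /\ normc (cplx y.1) < q ^+ k].
    rewrite (_ : mkset _ = [set y | q ^+ k.+1 <= normc (cplx y.1)] `&`
      [set y | normc (cplx y.1) < q ^+ k])//.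
    by apply: measurableI; [apply: measurable_le_set|apply: measurable_lt_set].
  have := affine_small_ball_le_cond C0 (qn0 k.+1) (ltW (qn0 m.+1))
    (mF : measurable [set y | Q (cplx y.1)]) bub (fun y => @proj1 _ _).
  move=> /le_trans; apply.
  (* The conditional bound grows like q^(-2k) and the level has probability of order q^(2k): these
     cancel, leaving (eps / q)^2 = q^(2m) for every [k]. *)
  apply: (@le_trans _ _ ((C * (eps / q ^+ k.+1) ^+ 2)%:E * (D * (q ^+ k) ^+ 2)%:E)%E).
    apply: lee_pmul => //; first by rewrite lee_fin mulr_ge0 ?sqr_ge0.
    apply: le_trans (Wub _ (ltW (qn0 k))); apply: le_measure; rewrite ?inE//.
      exact: mV.
    by move=> t /= [].
  rewrite -EFinM lee_fin le_eqVlt; apply/orP; left; apply/eqP.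
  rewrite /eps !exprS; field.
  by rewrite !gt_eqF.
have step k : (P (S `&` W 1%R) <= P (S `&` W (q ^+ k)%R) + (k%:R * (C * D) * q ^+ m ^+ 2)%:E)%E.
  elim: k => [|k IH]; first by rewrite expr0 !mul0r adde0.
  apply: le_trans IH _.
  apply: (@le_trans _ _ ((P (S `&` W (q ^+ k.+1)%R) + (C * D * q ^+ m ^+ 2)%:E) +
     (k%:R * (C * D) * q ^+ m ^+ 2)%:E)%E).
    apply: leeD => //; apply: le_trans (leeD (le_refl _) (layer k)).
    apply: le_trans (measureU2 P _ _); [|exact: measurableI..].
    apply: le_measure; rewrite ?inE; [exact: measurableI| |].
      by apply: measurableU; exact: measurableI.
    move=> t /= [St Wt]; have [h|h] := ltP (normc (w t)) (q ^+ k.+1); first by left.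
    by right.
  rewrite -addeA -EFinD leeD// lee_fin -natr1; lra.
have far : (P (S `&` [set t | (1 <= normc (w t))%R]) <= (C * q ^+ m ^+ 2)%:E)%E.
  pose Q (z : R[i]) := 1 <= normc z.
  have mF : measurable [set y : (R * R) * (R * R) | 1 <= normc (cplx y.1)].
    by apply: measurable_le_set.
  have := affine_small_ball_le_cond C0 ltr01 (ltW (qn0 m.+1))
    (mF : measurable [set y | Q (cplx y.1)]) bub (fun y => id).
  move=> /le_trans; apply.
  apply: (@le_trans _ _ ((C * (eps / 1) ^+ 2)%:E * 1)%E).
    apply: lee_pmul => //; first by rewrite lee_fin mulr_ge0 ?sqr_ge0.
    by apply: probability_le1; apply: measurable_le_set.
  by rewrite mule1 lee_fin divr1 ler_wpM2l.
(* In the final constant, [C] comes from |w| >= 1, the term in [C * D] from the [m.+1] levels, and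
   [D] from the core |w| < eps, where only the smallness of [w] is used. *)
apply: (@le_trans _ _ (P (S `&` [set t | (1 <= normc (w t))%R]) + P (S `&` W 1%R))%E).
  apply: le_trans (measureU2 P _ _).
  - apply: le_measure; rewrite ?inE//.
      apply: measurableU; last exact: measurableI.
      by apply: measurableI => //; apply: measurable_le_set.
    by move=> t St; have [h|h] := leP 1 (normc (w t)); [left|right].
  - by apply: measurableI => //; apply: measurable_le_set.
  - exact: measurableI.
apply: le_trans (leeD far (step m.+1)) _.
apply: (@le_trans _ _ ((C * q ^+ m ^+ 2)%:E + ((D * eps ^+ 2)%:E +
   (m.+1%:R * (C * D) * q ^+ m ^+ 2)%:E))%E).
  apply: leeD => //; apply: leeD => //; apply: le_trans (Wub _ (ltW (qn0 m.+1))).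
  by apply: le_measure; rewrite ?inE//; exact: measurableI.
rewrite -!EFinD lee_fin.
have : D * eps ^+ 2 <= D * q ^+ m ^+ 2.
  by rewrite ler_wpM2l.
lra.
Qed.

(** The lower bound for discs needs a bounded centre [- r / w] and a radius comparable to [eps]. The
    event [F N] grants both: |r / w| <= N + 1, and the radius [eps / |w|] is at least eps / (N + 1).
    As [w] is almost surely nonzero, the events [F N] cover all but a null set, so one of them has
    positive probability. *)
Lemma affine_small_ball_ge :
  (forall L, exists2 c : R, 0 < c & forall z s, normc z <= L -> 0 < s <= 1 ->
     ((c * s ^+ 2)%:E <= P [set t | (normc (b t - z) < s)%R])%E) ->
  P [set t | (normc (w t) <= 0)%R] = 0%E ->
  exists2 c : R, 0 < c & forall eps, 0 < eps <= 1 ->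
    ((c * eps ^+ 2)%:E <= P [set t | (normc (b t * w t + r t) < eps)%R])%E.
Proof.
move=> blb w0.
pose F (N : nat) : set ((R * R) * (R * R)) := [set y | 0 < normc (cplx y.1)] `&`
  ([set y | normc (cplx y.1) <= N.+1%:R] `&`
   [set y | normc (cplx y.2) <= N.+1%:R * normc (cplx y.1)]).
have mF N : measurable (F N).
  apply: measurableI; first by apply: measurable_lt_set.
  apply: measurableI; first by apply: measurable_le_set.
  by apply: measurable_le_set => //; exact: measurable_funM.
have FE k t : F k (re_im (w t), re_im (r t)) = (0 < normc (w t) /\
    normc (w t) <= k.+1%:R /\ normc (r t) <= k.+1%:R * normc (w t)) :> Prop.
  by rewrite /F; case: (w t) (r t) => [? ?] [? ?].
pose G N := [set t | F N (re_im (w t), re_im (r t))].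
have mG N : measurable (G N).
  rewrite -[X in measurable X]setTI; apply: (measurable_fun_pair mw mr) => //; exact: mF.
have [N GN] : exists N, P (G N) != 0%E.
  apply: contrapT => /forallNP H.
  have H0 N : P (G N) = 0%E by apply/eqP/negPn/negP; exact: H.
  have : P setT = 0%E.
    apply: measure_negligible => //.
    rewrite (_ : setT = [set t | normc (w t) <= 0] `|` \bigcup_N G N).
      apply: negligibleU; last first.
        by apply: negligible_bigcup => k; exists (G k); split => //; exact: H0.
      by exists [set t | normc (w t) <= 0]; split => //; exact: measurable_normc_le.
    apply/esym/seteqP; split => // t _ /=.
    have [h|h] := leP (normc (w t)) 0; [by left|right].
    pose a := Num.max (normc (w t)) (normc (r t) / normc (w t)).
    have a0 : 0 <= a by rewrite le_max normc_ge0.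
    have /andP[_ aN] := truncn_itv a0.
    exists (Num.truncn a) => //; rewrite /G /mkset FE; split => //; split.
      by apply: le_trans (ltW aN); rewrite le_max lexx.
    by rewrite -ler_pdivrMr//; apply: le_trans (ltW aN); rewrite le_max lexx orbT.
  by rewrite probability_setT => /eqP; rewrite onee_eq0.
have GN0 : 0 < fine (P (G N)).
  by rewrite fine_gt0// lt_neqAle eq_sym GN measure_ge0/= ltey_eq fin_num_measure.
have [c c0 clb] := blb N.+1%:R.
have N0 : 0 < N.+1%:R :> R by rewrite ltr0n.
exists (c / N.+1%:R ^+ 2 * fine (P (G N))).
  by rewrite mulr_gt0// divr_gt0// exprn_gt0.
move=> eps /andP[eps0 eps1].
have := @indep_prob_ge _ _ _ T _ _ R P (fun t => (re_im (w t), re_im (r t))) (fun t => re_im (b t))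
  (measurable_fun_pair mw mr) mb indep_b (E eps) (F N) (c * (eps / N.+1%:R) ^+ 2) (mE eps) (mF N).
have -> : [set t | E eps ((re_im (w t), re_im (r t)), re_im (b t))] =
    [set t | normc (b t * w t + r t) < eps].
  by apply/funext => t; rewrite /mkset E_re_im.
move=> H; apply: le_trans (H _ _).
- rewrite -/(G N) -[P (G N)]fineK ?fin_num_measure// -EFinM lee_fin.
  by rewrite le_eqVlt; apply/orP; left; apply/eqP; field; rewrite gt_eqF.
- by rewrite mulr_ge0 ?sqr_ge0// ltW.
- move=> p [y0 [yN zN]]; rewrite /mkset in y0 yN zN.
  set y := cplx p.1 in y0 yN zN; set z := cplx p.2 in zN.
  have yn0 : y != 0 by apply: contraTneq y0 => ->; rewrite ComplexField.Normc.normc0 ltxx.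
  under eq_set => t do rewrite E_cplx.
  rewrite -/y -/z.
  apply: le_trans (clb (- z / y) _ _ _) _.
  + rewrite ComplexField.Normc.normcM ComplexField.Normc.normcV normcN.
    by rewrite ler_pdivrMr.
  + rewrite divr_gt0//= ler_pdivrMr// mul1r; apply: le_trans eps1 _.
    by rewrite ler1n.
  apply: le_measure; rewrite ?inE.
  + apply: measurable_lt_set => //; apply: measurable_normc.
    by apply: complex_rvD => //; exact: complex_rv_cst.
  + apply: measurable_lt_set => //; apply: measurable_normc.
    apply: complex_rvD; last exact: complex_rv_cst.
    by apply: complex_rvM => //; exact: complex_rv_cst.
  + move=> t /=; rewrite affine_normc// => h.
    rewrite ltr_pdivrMr// in h; apply: lt_le_trans h _.
    by rewrite -mulrA ger_pMr// mulrC ler_pdivrMr// mul1r.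
Qed.

End AffineSmallBall.

(** * Diversity order from polynomial bounds *)

Section Asymptotics.
Context {R : realType}.

(** After taking logarithms the constants contribute only O(1 / ln p), and m / (m + 2) = 1 - 2 / (m
    + 2) is as close to 1 as desired. The constant [C] may depend on [m], which is fixed before [p]
    grows. *)
Lemma cvg_diversity_ratio (Pout : R -> R) :
  (exists2 c : R, 0 < c & \forall p \near +oo, c * expR (- ln p) <= Pout p) ->
  (forall m : nat, exists2 C : R, 0 < C &
     \forall p \near +oo, Pout p <= C * expR (- (m%:R / m.+2%:R * ln p))) ->
  diversity_ratio Pout p @[p --> +oo] --> (-1 : R).
Proof.
move=> [c c0 lo] hi; apply/cvgrPdist_le => e e0.
pose m := Num.truncn (4 / e).
have m4 : 2 / m.+2%:R <= e / 2.
  have /andP[_ h] : (m%:R <= 4 / e < m.+1%:R) by apply: truncn_itv; rewrite divr_ge0// ltW.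
  rewrite ler_pdivrMr ?ltr0n// mulrAC ler_pdivlMr// mulrC.
  rewrite ltr_pdivrMr// in h.
  have : m.+1%:R <= m.+2%:R :> R by rewrite ler_nat.
  by nra.
have [C C0 hiC] := hi m.
(* From [ln p >= K] on, the logarithms of the constants cost at most [e / 2] in the ratio, the other
   half being left for 2 / (m + 2); the summand 1 keeps [ln p] positive. *)
pose K := 1 + 2 / e * (`|ln c| + `|ln C|).
near=> p.
have lop : c * expR (- ln p) <= Pout p by near: p; exact: lo.
have hip : Pout p <= C * expR (- (m%:R / m.+2%:R * ln p)) by near: p; exact: hiC.
have Kp : expR K <= p by near: p; exact: nbhs_pinfty_ge.
have p0 : 0 < p by apply: lt_le_trans Kp; exact: expR_gt0.
have Kx : K <= ln p by rewrite -ler_expR lnK.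
set x := ln p in Kx lop hip.
have n0 : 0 <= 2 / e * (`|ln c| + `|ln C|).
  by rewrite mulr_ge0 ?divr_ge0 ?addr_ge0// ltW.
have x0 : 0 < x by rewrite (lt_le_trans _ Kx)// /K; lra.
have Kx2 : `|ln c| + `|ln C| <= e / 2 * x.
  have : 2 / e * (`|ln c| + `|ln C|) <= x by apply: le_trans Kx; rewrite /K; lra.
  rewrite mulrAC ler_pdivrMr//; lra.
have P0 : 0 < Pout p by apply: lt_le_trans lop; rewrite mulr_gt0// expR_gt0.
have lo' : ln c - x <= ln (Pout p).
  have := lop; rewrite -ler_ln ?posrE ?mulr_gt0 ?expR_gt0//.
  by rewrite lnM ?posrE ?expR_gt0// expRK.
have hi' : ln (Pout p) <= ln C - m%:R / m.+2%:R * x.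
  have := hip; rewrite -ler_ln ?posrE ?mulr_gt0 ?expR_gt0//.
  by rewrite lnM ?posrE ?expR_gt0// expRK.
have mE : m%:R / m.+2%:R = 1 - 2 / m.+2%:R :> R.
  by rewrite -(natr1 m.+1) -(natr1 m); field; rewrite (natr1 m) natr1 pnatr_eq0.
have := ler_norm (ln C); have := ler_norm (- ln c); rewrite normrN => h1 h2.
have a1 := normr_ge0 (ln c); have a2 := normr_ge0 (ln C).
rewrite /diversity_ratio -/x -opprD normrN ler_norml.
have -> : 1 + ln (Pout p) / x = (x + ln (Pout p)) / x by field; rewrite gt_eqF.
rewrite ler_pdivlMr// ler_pdivrMr//.
apply/andP; split; first by nra.
rewrite mE in hi'.
have : 2 / m.+2%:R * x <= e / 2 * x by rewrite ler_wpM2r// ltW.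
have -> : e * x = e / 2 * x + e / 2 * x by field.
move: (2 / m.+2%:R) hi' => u; rewrite mulrBl mul1r; move: (u * x) (e / 2 * x) Kx2 => ux ex.
lra.
Unshelve. all: by end_near.
Qed.

(** Squaring 1 + y <= e^y at y = x / (2k) gives a quadratic lower bound. With x = ln p, this absorbs
    the logarithmic noise level into p^(1/k). *)
Lemma linear_le_expR (A B k : R) : 0 <= A -> 0 <= B -> 0 < k ->
  exists x0 : R, forall x, x0 <= x -> A * x + B <= expR (x / k).
Proof.
move=> A0 B0 k0; exists (1 + 4 * k ^+ 2 * (A + B)) => x xx0.
have k2 : 0 < 4 * k ^+ 2 by rewrite mulr_gt0// exprn_gt0.
have x1 : 1 <= x by apply: le_trans xx0; rewrite lerDl mulr_ge0 ?addr_ge0// ltW.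
have h : 1 + x / k / 2 <= expR (x / k / 2) by exact: expR_ge1Dx.
have xk : 0 <= x / k / 2 by rewrite !divr_ge0// ?ltW//; lra.
apply: (@le_trans _ _ ((x / k / 2) ^+ 2)); last first.
  have -> : expR (x / k) = expR (x / k / 2) ^+ 2.
    by rewrite expr2 -expRD -splitr.
  by rewrite lerXn2r ?nnegrE ?expR_ge0//; lra.
have -> : (x / k / 2) ^+ 2 = x * (x / (4 * k ^+ 2)) by field; rewrite gt_eqF.
have : A + B <= x / (4 * k ^+ 2).
  by rewrite ler_pdivlMr//; lra.
nra.
Qed.

End Asymptotics.

(** * Algebra of the coupled phases *)

Section Phases.
Context {R : realType}.
Implicit Types (a b z : R[i]) (x : R).

(** The factor u_m of the overview; its value at [a = 0] is 0, so it is unimodular only for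
    [a != 0]. *)
Definition conj_phase a : R[i] := a^*%C * ((normc a)^-1)%:C.

Lemma normc_cis x : normc (cis x) = 1.
Proof. by rewrite /cis /= cos2Dsin2 sqrtr1. Qed.

Lemma normc_real x : normc (x%:C) = `|x|.
Proof. by rewrite /= expr0n/= addr0 sqrtr_sqr. Qed.

Lemma cis_subpi2 x : cis (x - pi / 2) = - 'i%C * cis x.
Proof. by rewrite /cis cosB sinB cos_pihalf sin_pihalf; simpc. Qed.

Lemma normc_conj_phase a : a != 0 -> normc (conj_phase a) = 1.
Proof.
move=> a0; rewrite ComplexField.Normc.normcM normc_real.
have na0 : 0 < normc a.
  rewrite lt_neqAle normc_ge0 andbT eq_sym; apply: contra_neq a0.
  exact: ComplexField.Normc.eq0_normc.
rewrite ger0_norm ?invr_ge0 ?normc_ge0//.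
have -> : normc (a^*%C) = normc a by case: a {a0 na0} => x y /=; rewrite sqrrN.
by rewrite divff// gt_eqF.
Qed.

(** Multiplying the cophase identity by the conjugate of [a] over |a|^2 determines e^(jx) b, also
    when [b = 0]. The coupling then only contributes the factor -i, common to all elements and
    invisible in the modulus of the sum. *)
Lemma cophase_transmission a b x y : a != 0 ->
  a * cis x * b = `|a| * `|b| -> x - y = pi / 2 ->
  cis y * b = - 'i%C * ((normc b)%:C * conj_phase a).
Proof.
move=> a0 cop xy; have -> : y = x - pi / 2 by rewrite -xy subKr.
rewrite cis_subpi2 -mulrA; congr (_ * _).
have a0' : (normc a)%:C != 0 :> R[i].
  by apply: contra_neq a0 => /eq0_normC.
have aa : a * a^*%C = (normc a)%:C * (normc a)%:C.
  case: a {a0 a0' cop} => p q; rewrite -rmorphM/= -expr2 sqr_sqrtr ?addr_ge0 ?sqr_ge0//.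
  by simpc; congr (_ +i* _); ring.
have cop' : a * cis x * b = (normc a)%:C * (normc b)%:C by [].
rewrite /conj_phase fmorphV/=.
apply: (mulfI a0); rewrite !mulrA cop'.
rewrite (mulrC a) -(mulrA _ a) aa; field.
exact: a0'.
Qed.

End Phases.

(** * The signal received by user B *)

Section OtherVariables.
Context d (T : measurableType d) (R : realType) (P : probability T R).
Variables (I : finType) (X : I -> T -> R[i]) (i0 : I).

(** Measurability on [TG] expresses dependence on the links other than [i0] alone. Independence of a
    composite expression from [X i0] thus follows from the closure properties of [complex_rv],
    without writing it as a function of a tuple. *)
Let TG : measurableType _ := g_sigma_algebraType (other_cylinders X i0).

Lemma complex_rv_other i : i != i0 -> complex_rv (X i : TG -> R[i]).
Proof.
move=> ii0 _ B mB; rewrite setTI; apply: sub_gen_smallest.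
exists (fun j => if j == i then B else setT).
  by move=> j; case: ifP.
apply/seteqP; split => t /=.
  by move=> Bt j _; case: eqP => [->|].
by move=> /(_ i ii0); rewrite eqxx.
Qed.

Lemma indep_other_pair (w r : T -> R[i]) :
  (forall i, complex_rv (X i)) -> mutually_independent P X ->
  complex_rv (w : TG -> R[i]) -> complex_rv (r : TG -> R[i]) ->
  forall (A : set ((R * R) * (R * R))) (B : set (R * R)),
  measurable A -> measurable B ->
  P [set t | A (re_im (w t), re_im (r t)) /\ B (re_im (X i0 t))] =
  (P [set t | A (re_im (w t), re_im (r t))] * P [set t | B (re_im (X i0 t))])%E.
Proof.
move=> mX indepX mw mr A B mA mB.
rewrite muleC -(@indep_sigma_other _ _ _ _ _ _ i0 mX indepX B)//.
  by congr (P _); apply/seteqP; split => t /= [].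
have := measurable_fun_pair mw mr measurableT mA.
by rewrite setTI.
Qed.

Lemma complex_rv_sub (w : T -> R[i]) : (forall i, complex_rv (X i)) ->
  complex_rv (w : TG -> R[i]) -> complex_rv w.
Proof.
move=> mX mw _ B mB; have := mw measurableT B mB.
rewrite setTI => sB.
exact: (smallest_sub (sigma_algebra_measurable T) (measurable_other_cylinders mX) sB).
Qed.

End OtherVariables.

Lemma normc_le0 (R : realType) (z : R[i]) : (normc z <= 0) = (z == 0).
Proof.
apply/idP/eqP => [h|->]; last by rewrite ComplexField.Normc.normc0.
by apply: ComplexField.Normc.eq0_normc; apply/eqP; rewrite eq_le h normc_ge0.
Qed.

Section RicianFamily.
Context d (T : measurableType d) (R : realType) (P : probability T R).

Lemma rician_null K O X : 0 <= K -> 0 < O -> rician P K O X ->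
  P [set t | (normc (X t) <= 0)%R] = 0%E.
Proof.
move=> K0 O0 XP; have [C C0 /(_ 0 0 (lexx _))] := rician_disc_le K0 O0 XP.
rewrite expr0n/= mulr0 (_ : [set t | normc (X t - 0) <= 0] = [set t | normc (X t) <= 0]).
  by rewrite measure_le0 => /eqP.
by apply/funext => t; rewrite /mkset subr0.
Qed.

Lemma fin_union_bound (M : nat) (B : 'I_M -> set T) (c : R) : (forall m, measurable (B m)) ->
  (forall m, (P (B m) <= c%:E)%E) ->
  measurable [set t | exists m, B m t] /\
  (P [set t | exists m, B m t] <= (M%:R * c)%:E)%E.
Proof.
move=> mB Bc.
have [mU PU] : let U s := [set t | exists2 m, m \in s & B m t] in
    measurable (U (enum 'I_M)) /\ (P (U (enum 'I_M)) <= ((size (enum 'I_M))%:R * c)%:E)%E.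
  elim: (enum 'I_M) => [|m s [/= mU PU]] /=.
    rewrite (_ : [set t | _] = set0); first by rewrite measure0 mul0r.
    by apply/seteqP; split => t //= -[m]; rewrite in_nil.
  rewrite (_ : [set t | exists2 m', m' \in m :: s & B m' t] =
      B m `|` [set t | exists2 m, m \in s & B m t]).
    split; first exact: measurableU.
    apply: le_trans (measureU2 P (mB m) mU) _.
    apply: le_trans (leeD (Bc m) PU) _.
    by rewrite -EFinD lee_fin -(natr1 (size s)); lra.
  apply/seteqP; split => t /=.
    move=> [k]; rewrite in_cons => /predU1P[->|ks Bk]; first by left.
    by right; exists k.
  move=> [Bm|[k ks Bk]]; first by exists m => //; rewrite mem_head.
  by exists k => //; rewrite in_cons ks orbT.
have UE : [set t | exists2 m, m \in enum 'I_M & B m t] = [set t | exists m, B m t].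
  by apply/seteqP; split => t /= [m]; exists m => //; rewrite mem_enum.
by move: mU PU; rewrite UE size_enum_ord.
Qed.

Variables (M : nat) (K Om : R) (X : 'I_M -> T -> R[i]).
Hypotheses (K0 : 0 <= K) (Om0 : 0 < Om) (XP : forall m, rician P K Om (X m)).

Definition some_null : set T := [set t | exists m, X m t = 0].

Lemma prob_some_null : measurable some_null /\ P some_null = 0%E.
Proof.
have mX m : measurable [set t | normc (X m t) <= 0].
  exact: measurable_normc_le (rician_rv K0 Om0 (XP m)).
have [m|mN PN] := @fin_union_bound _ (fun m => [set t | normc (X m t) <= 0]) 0 mX.
  by rewrite (rician_null K0 Om0).
rewrite (_ : some_null = [set t | exists m, normc (X m t) <= 0]).
  by split => //; apply/eqP; rewrite -measure_le0; move: PN; rewrite mulr0.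
by apply/seteqP; split => t [m hm]; exists m; move: hm; rewrite normc_le0 => /eqP.
Qed.

End RicianFamily.

Definition cophase_weight (R : realType) (a z : R[i]) : R[i] :=
  (normc z)%:C * conj_phase a.

(* Up to a unimodular factor and the gain GB, the signal received by user B
   when user A is cophased. *)
Definition coupled_sum (R : realType) (M : nat) (a b z : 'I_M -> R[i]) : R[i] :=
  \sum_(m < M) b m * cophase_weight (a m) (z m).

Section CoupledSum.
Context (d : measure_display) (T : measurableType d) (R : realType)
    (P : probability T R) (M : nat) (hM : (1 <= M)%N)
    (Kg Og KA OA KB OB : R)
    (hKg : 0 <= Kg) (hOg : 0 < Og)
    (hKA : 0 <= KA) (hOA : 0 < OA)
    (hKB : 0 <= KB) (hOB : 0 < OB)
    (g hA hB : 'I_M -> T -> R[i])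
    (g_rician : forall m, rician P Kg Og (g m))
    (hA_rician : forall m, rician P KA OA (hA m))
    (hB_rician : forall m, rician P KB OB (hB m))
    (indep : mutually_independent P (all_links hA hB g)).

Let m0 : 'I_M := Ordinal hM.

Let weight m t := cophase_weight (hA m t) (g m t).

Let S t := coupled_sum (fun m => hA m t) (fun m => hB m t) (fun m => g m t).

Let rest t := \sum_(m < M | m != m0) hB m t * weight m t.

Let coupled_sumE t : S t = hB m0 t * weight m0 t + rest t.
Proof. by rewrite /S /coupled_sum (bigD1 m0). Qed.

Let mlinks l : complex_rv (all_links hA hB g l).
Proof.
by case: l => [[m|m]|m] /=; [exact: (rician_rv hKA hOA (hA_rician m))|
  exact: (rician_rv hKB hOB (hB_rician m))|exact: (rician_rv hKg hOg (g_rician m))].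
Qed.

Let i0 : 'I_M + 'I_M + 'I_M := inl (inr m0).

Let TG : measurableType _ := g_sigma_algebraType (other_cylinders (all_links hA hB g) i0).

Let complex_rv_weight m : complex_rv (weight m : TG -> R[i]).
Proof.
apply: complex_rvM.
  apply: complex_rv_real; apply: measurable_normc.
  exact: (@complex_rv_other _ T R _ (all_links hA hB g) i0 (inr m)).
apply: complex_rv_phase.
exact: (@complex_rv_other _ T R _ (all_links hA hB g) i0 (inl (inl m))).
Qed.

Let complex_rv_rest : complex_rv (rest : TG -> R[i]).
Proof.
apply: complex_rv_sum => m mm0; apply: complex_rvM; last exact: complex_rv_weight.
apply: (@complex_rv_other _ T R _ (all_links hA hB g) i0 (inl (inr m))).
by apply: contra_neq mm0 => -[].
Qed.

Let mweight m : complex_rv (weight m).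
Proof. exact: (complex_rv_sub mlinks (complex_rv_weight m)). Qed.

Let mrest : complex_rv rest.
Proof. exact: (complex_rv_sub mlinks complex_rv_rest). Qed.

Lemma complex_rv_coupled_sum : complex_rv S.
Proof.
apply: complex_rv_sum => m _; apply: complex_rvM; last exact: mweight.
exact: (mlinks (inl (inr m))).
Qed.

Let indep_b := @indep_other_pair _ T R P _ _ i0 _ _ mlinks indep
  (complex_rv_weight m0) complex_rv_rest.

(** The modulus of the weight is |g| except on the null event where some [hA] vanishes. *)
Let weight_disc_le s : (P [set t | (normc (weight m0 t) <= s)%R] <=
  P [set t | (normc (g m0 t) <= s)%R])%E.
Proof.
have [mN PN] := prob_some_null hKA hOA hA_rician.
have mgs : measurable [set t | normc (g m0 t) <= s].
  exact: measurable_normc_le (mlinks (inr m0)).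
rewrite -[leRHS]adde0 -PN; apply: le_trans (measureU2 P mgs mN).
apply: le_measure; rewrite ?inE; [exact: measurable_normc_le|exact: measurableU|].
move=> t /=; have [ha|ha] := eqVneq (hA m0 t) 0; first by right; exists m0.
rewrite /weight /cophase_weight ComplexField.Normc.normcM normc_conj_phase//.
by rewrite mulr1 normc_real ger0_norm ?normc_ge0//; left.
Qed.

Lemma coupled_sum_le : exists2 C : R, 0 < C & forall (m : nat) (q : R), 0 < q < 1 ->
  (P [set t | (normc (S t) < q ^+ m.+1)%R] <= (C * m.+1%:R * q ^+ m ^+ 2)%:E)%E.
Proof.
have [C C0 bub] := rician_disc_le hKB hOB (hB_rician m0).
have [D D0 gub] := rician_disc_le hKg hOg (g_rician m0).
(* The 1 only ensures positivity; since [m.+1 >= 1], the dependence on [m] can be factored out. *)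
exists (1 + C + D + C * D).
  by rewrite !ltr_wpDr ?mulr_ge0.
move=> m q q01.
have wub s : 0 <= s ->
    (P [set t | (normc (weight m0 t) <= s)%R] <= (D * s ^+ 2)%:E)%E.
  move=> s0; apply: le_trans (weight_disc_le s) _; apply: le_trans (gub 0 s s0).
  by under [X in (_ <= P X)%E]eq_set => t do rewrite subr0.
have := affine_small_ball_le (mlinks i0) (mweight m0) mrest indep_b m C0 D0 q01 bub wub.
rewrite (_ : [set t | _] = [set t | normc (S t) < q ^+ m.+1]).
  move=> /le_trans; apply; rewrite lee_fin ler_wpM2r ?sqr_ge0//.
  have m1 : 1 <= m.+1%:R :> R by rewrite ler1n.
  have CD : 0 <= C * D by rewrite mulr_ge0.
  by nra.
by apply/funext => t; rewrite /mkset coupled_sumE.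
Qed.

Lemma coupled_sum_ge : exists2 c : R, 0 < c & forall eps, 0 < eps <= 1 ->
  ((c * eps ^+ 2)%:E <= P [set t | (normc (S t) < eps)%R])%E.
Proof.
have blb L := rician_disc_ge hKB hOB (hB_rician m0) L.
have w0 : P [set t | (normc (weight m0 t) <= 0)%R] = 0%E.
  apply/eqP; rewrite -measure_le0 -(rician_null hKg hOg (g_rician m0)).
  exact: weight_disc_le.
have [c c0 H] := affine_small_ball_ge (mlinks i0) (mweight m0) mrest indep_b blb w0.
exists c => // eps e01; apply: le_trans (H _ e01) _.
rewrite le_eqVlt; apply/orP; left; apply/eqP; congr (P _).
by apply/funext => t; rewrite /mkset coupled_sumE.
Qed.

End CoupledSum.

(** * From the SNR to the modulus of [coupled_sum] *)

Section SnrBounds.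
Context {R : realType} {M : nat}.
Implicit Types (a b z : R[i]).

Lemma normc_sum (I : Type) (s : seq I) (F : I -> R[i]) :
  normc (\sum_(i <- s) F i) <= \sum_(i <- s) normc (F i).
Proof.
elim: s => [|i s IH]; first by rewrite !big_nil ComplexField.Normc.normc0.
by rewrite !big_cons; apply: le_trans (normcD _ _) _; rewrite lerD2l.
Qed.

Lemma normc_received (GB : R) (h g : 'I_M -> R[i]) (a : 'I_M -> R[i]) (x y : 'I_M -> R) :
  0 < GB -> (forall m, a m != 0) ->
  (forall m, a m * cis (x m) * g m = `|a m| * `|g m|) ->
  (forall m, x m - y m = pi / 2) ->
  normc (\sum_(m < M) h m * GB%:C * cis (y m) * g m) =
  GB * normc (coupled_sum a h g).
Proof.
move=> GB0 a0 cop xy.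
rewrite (_ : \sum_(m < M) _ = (- 'i%C * GB%:C) * coupled_sum a h g).
  rewrite !ComplexField.Normc.normcM normc_real gtr0_norm// normcN.
  rewrite (_ : normc 'i%C = 1) ?mul1r//.
  by rewrite /= expr0n expr1n add0r sqrtr1.
rewrite mulr_sumr; apply: eq_bigr => m _; rewrite /cophase_weight.
rewrite -mulrA (cophase_transmission (a0 m) (cop m) (xy m)); ring.
Qed.

(** The phases enter only through the modulus 1 of [cis], so the bound is uniform in them. *)
Lemma normc_noise (GB L : R) (h : 'I_M -> R[i]) (y : 'I_M -> R) :
  0 < GB -> (forall m, normc (h m) <= L) ->
  normc (\sum_(m < M) h m * GB%:C * cis (y m)) <= M%:R * (L * GB).
Proof.
move=> GB0 hL; apply: le_trans (normc_sum _ _) _.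
apply: (@le_trans _ _ (\sum_(m < M) L * GB)).
  apply: ler_sum => m _; rewrite !ComplexField.Normc.normcM normc_cis mulr1.
  by rewrite normc_real gtr0_norm// ler_pM2r.
by rewrite sumr_const card_ord mulr_natl.
Qed.

Lemma snr_lt (p sv2 su2 target : R) (G : 'I_M -> R) (h g : 'I_M -> R[i]) (y : 'I_M -> R) :
  0 < sv2 -> 0 < su2 ->
  (snr p sv2 su2 G h g y < target) =
  (p * normc (\sum_(m < M) h m * (G m)%:C * cis (y m) * g m) ^+ 2 <
   target * (normc (\sum_(m < M) h m * (G m)%:C * cis (y m)) ^+ 2 * sv2 + su2)).
Proof.
move=> sv0 su0; rewrite /snr ltr_pdivrMr//.
by rewrite ltr_wpDl// mulr_ge0 ?sqr_ge0// ltW.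
Qed.

End SnrBounds.

(** * The outage probability between two powers of p *)

Theorem corollary2 (d : measure_display) (T : measurableType d) (R : realType)
    (P : probability T R) (M : nat) (hM : (1 <= M)%N)
    (Kg Og KA OA KB OB : R)
    (hKg : 0 <= Kg) (hOg : 0 < Og)
    (hKA : 0 <= KA) (hOA : 0 < OA)
    (hKB : 0 <= KB) (hOB : 0 < OB)
    (g hA hB : 'I_M -> T -> R[i])
    (g_rician : forall m, rician P Kg Og (g m))
    (hA_rician : forall m, rician P KA OA (hA m))
    (hB_rician : forall m, rician P KB OB (hB m))
    (indep : mutually_independent P (all_links hA hB g))
    (phiA phiB : 'I_M -> {RV P >-> R})
    (cophase : forall (m : 'I_M) (t : T),
        hA m t * cis (phiA m t) * g m t = `|hA m t| * `|g m t|)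
    (coupling : forall (m : 'I_M) (t : T), phiA m t - phiB m t = pi / 2)
    (GB sv2 sB2 target : R)
    (hGB : 0 < GB) (hsv2 : 0 < sv2) (hsB2 : 0 < sB2) (htarget : 0 < target) :
  let gammaB (p : R) (t : T) :=
    snr p sv2 sB2 (fun=> GB) (fun m => hB m t) (fun m => g m t)
      (fun m => phiB m t) in
  let Pout (p : R) := outage_probability P (gammaB p) target in
  cvg (diversity_ratio Pout p @[p --> +oo]) /\ diversity_order Pout = 1.
Proof.
move=> gammaB Pout.
suff H : diversity_ratio Pout p @[p --> +oo] --> (-1 : R).
  split; first by apply/cvg_ex; exists (-1).
  by rewrite /diversity_order (cvg_lim _ H) ?opprK//; exact: norm_hausdorff.
pose S t := coupled_sum (fun m => hA m t) (fun m => hB m t) (fun m => g m t).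
pose N := some_null hA.
have mg m : complex_rv (g m) := rician_rv hKg hOg (g_rician m).
have mhB m : complex_rv (hB m) := rician_rv hKB hOB (hB_rician m).
have mphi m : complex_rv (fun t => cis (phiB m t)).
  by apply: complex_rv_cis; exact: measurable_funPT.
have mS : complex_rv S.
  exact: (complex_rv_coupled_sum hM hKg hOg hKA hOA hKB hOB g_rician hA_rician hB_rician).
have [mN PN] : measurable N /\ P N = 0%E := prob_some_null hKA hOA hA_rician.
pose O p := [set t | gammaB p t < target].
have mO p : measurable (O p).
  rewrite (_ : O p = [set t |
    p * normc (\sum_(m < M) hB m t * GB%:C * cis (phiB m t) * g m t) ^+ 2 <
    target * (normc (\sum_(m < M) hB m t * GB%:C * cis (phiB m t)) ^+ 2 * sv2 + sB2)]).
    apply: measurable_lt_set.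
      apply: measurable_funM => //; apply: measurable_funX; apply: measurable_normc.
      apply: complex_rv_sum => m _; apply: complex_rvM => //; apply: complex_rvM => //.
      by apply: complex_rvM => //; exact: complex_rv_cst.
    apply: measurable_funM => //; apply: measurable_funD => //.
    apply: measurable_funM => //; apply: measurable_funX; apply: measurable_normc.
    apply: complex_rv_sum => m _; apply: complex_rvM => //.
    by apply: complex_rvM => //; exact: complex_rv_cst.
  by apply/funext => t; rewrite /O /mkset /gammaB snr_lt//.
have PoutE p : (Pout p)%:E = P (O p).
  by rewrite /Pout /outage_probability fineK ?fin_num_measure//; exact: mO.
have mSlt s : measurable [set t | normc (S t) < s] := measurable_normc_lt s mS.
have received t : ~ N t ->
    normc (\sum_(m < M) hB m t * GB%:C * cis (phiB m t) * g m t) = GB * normc (S t).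
  move=> Nt; apply: (normc_received _ hGB _ (fun m => cophase m t) (fun m => coupling m t)).
  by move=> m; apply/eqP => hm; apply: Nt; exists m.
have Nlift A : measurable A -> (P (A `|` N) <= P A)%E.
  by move=> mA; rewrite -[leRHS]adde0 -PN; exact: measureU2.
apply: cvg_diversity_ratio.
- have [c c0 Slb] := coupled_sum_ge hM hKg hOg hKA hOA hKB hOB g_rician hA_rician hB_rician indep.
  (* Amplified noise can only favour outage, so the user noise alone gives a sufficient condition:
     |S|^2 < a / p. *)
  pose a := target * sB2 / GB ^+ 2.
  have a0 : 0 < a by rewrite divr_gt0 ?mulr_gt0// exprn_gt0.
  exists (c * a); first exact: mulr_gt0.
  near=> p.
  have pa : a <= p by near: p; apply: nbhs_pinfty_ge; exact: num_real.
  have p0 : 0 < p := lt_le_trans a0 pa.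
  have ap0 : 0 < a / p by rewrite divr_gt0.
  rewrite expRN lnK// -lee_fin PoutE; apply: le_trans (Nlift _ (mO p)).
  have e1 : 0 < Num.sqrt (a / p) <= 1.
    by rewrite sqrtr_gt0 ap0 -sqrtr1 ler_wsqrtr// ler_pdivrMr// mul1r.
  have := Slb _ e1; rewrite sqr_sqrtr ?(ltW ap0)// mulrA => /le_trans; apply.
  apply: le_measure; rewrite ?inE//; first exact: measurableU.
  move=> t /= St; have [Nt|Nt] := pselect (N t); [by right|left].
  rewrite /O/= /gammaB snr_lt// received//.
  have : normc (S t) ^+ 2 < a / p.
    by rewrite -(sqr_sqrtr (ltW ap0)) ltrXn2r ?nnegrE ?sqrtr_ge0 ?normc_ge0.
  rewrite ltr_pdivlMr// /a ltr_pdivlMr ?exprn_gt0// => H.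
  rewrite exprMn; apply: (@lt_le_trans _ _ (target * sB2)); first by nra.
  by rewrite ler_pM2l// lerDr mulr_ge0 ?sqr_ge0// ltW.
- move=> m.
  have [C C0 Sub] := coupled_sum_le hM hKg hOg hKA hOA hKB hOB g_rician hA_rician hB_rician indep.
  have [D [k [L0 [D0 [k0 tail]]]]] := rician_tail P hKB hOB.
  (* If every |hB| is at most sqrt(ln p / k), outage implies p |S|^2 < A ln p + B. *)
  pose A := target * M%:R ^+ 2 * sv2 / k.
  pose B := target * sB2 / GB ^+ 2.
  have A0 : 0 <= A by rewrite divr_ge0 ?(ltW k0)// !mulr_ge0 ?sqr_ge0// ltW.
  have B0 : 0 <= B by rewrite divr_ge0 ?sqr_ge0// mulr_ge0// ltW.
  have m20 : 0 < m.+2%:R :> R by rewrite ltr0n.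
  have [x0 Hx0] := linear_le_expR A0 B0 m20.
  exists (C * m.+1%:R + M%:R * D).
    by rewrite ltr_wpDr ?mulr_ge0// mulr_gt0.
  near=> p.
  have p1 : 1 < p by near: p; apply: nbhs_pinfty_gt; exact: num_real.
  have p0 : 0 < p by exact: lt_trans p1.
  have px : expR (`|x0| + k * L0 ^+ 2) <= p by near: p; apply: nbhs_pinfty_ge; exact: num_real.
  pose x := ln p.
  have pE : p = expR x by rewrite lnK.
  have xx : `|x0| + k * L0 ^+ 2 <= x by rewrite -ler_expR -pE.
  have x0x : x0 <= x.
    apply: le_trans xx; apply: le_trans (ler_norm _) _.
    by rewrite lerDl mulr_ge0 ?sqr_ge0// ltW.
  have xp : 0 < x by rewrite ln_gt0.
  (* The level at which the Gaussian tail exp(- k L^2) equals 1 / p. *)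
  pose L := Num.sqrt (x / k).
  have LE : L ^+ 2 = x / k by rewrite sqr_sqrtr// divr_ge0// ltW.
  have L00 : L0 <= L.
    apply: le_trans (ler_norm _) _; rewrite -sqrtr_sqr ler_wsqrtr//.
    rewrite ler_pdivlMr// mulrC; apply: le_trans xx; by rewrite lerDr.
  (* Here q = p^(-1 / (2(m+2))), so the squared radius q^(2(m+1)) is p^(1/(m+2)) / p, exactly what
     the absorbed noise level requires, and the small ball bound q^(2m) is p^(-m/(m+2)). *)
  pose q := expR (- (x / (2 * m.+2%:R))).
  have q01 : 0 < q < 1.
    by rewrite expR_gt0 expR_lt1 oppr_lt0 divr_gt0// mulr_gt0.
  have qm j : q ^+ j ^+ 2 = expR (- (j%:R / m.+2%:R * x)).
    rewrite -exprM -expRM_natl; congr expR; rewrite natrM; field.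
    by rewrite gt_eqF.
  pose V := [set t | exists j, (L < normc (hB j t))%R].
  have [mV PV] : measurable V /\ (P V <= (M%:R * (D * expR (- x)))%:E)%E.
    apply: fin_union_bound => j.
      by apply: measurable_lt_set => //; exact: measurable_normc.
    apply: le_trans (tail _ _ (hB_rician j) L00) _.
    by rewrite LE mulrCA divff ?mulr1// gt_eqF.
  rewrite -lee_fin PoutE.
  apply: (@le_trans _ _ (P (([set t | (normc (S t) < q ^+ m.+1)%R] `|` V) `|` N))).
    apply: le_measure; rewrite ?inE//.
      by apply: measurableU => //; exact: measurableU.
    move=> t /= Ot; have [Nt|Nt] := pselect (N t); [by right|left].
    have [Vt|Vt] := pselect (V t); [by right|left].
    have hL j : normc (hB j t) <= L.
      by rewrite leNgt; apply/negP => hj; apply: Vt; exists j.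
    move: Ot; rewrite /O/= /gammaB snr_lt// received// exprMn.
    have := normc_noise (fun j => phiB j t) hGB hL.
    set nz := normc _ => nzL.
    have nz2 : nz ^+ 2 <= M%:R ^+ 2 * (x / k) * GB ^+ 2.
      rewrite -LE -!exprMn lerXn2r ?nnegrE ?normc_ge0// -?mulrA//.
      by rewrite !mulr_ge0// ?sqrtr_ge0// ltW.
    set s := normc (S t) => Ot.
    have G2 : 0 < GB ^+ 2 by rewrite exprn_gt0.
    have : p * s ^+ 2 < A * x + B.
      rewrite -(ltr_pM2r G2).
      have -> : (A * x + B) * GB ^+ 2 = target * (M%:R ^+ 2 * (x / k) * GB ^+ 2 * sv2 + sB2).
        by rewrite /A /B; field; rewrite !gt_eqF.
      rewrite mulrAC -mulrA; apply: lt_le_trans Ot _.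
      by rewrite ler_pM2l// lerD2r ler_pM2r.
    move=> /lt_le_trans/(_ (Hx0 _ x0x)) H.
    have : s ^+ 2 < (q ^+ m.+1) ^+ 2.
      rewrite qm -(ltr_pM2l p0); apply: lt_le_trans H _.
      rewrite pE -expRD ler_expR le_eqVlt; apply/orP; left; apply/eqP.
      have := ler0n R m.+1; rewrite -(natr1 m.+1); move: (m.+1%:R) => u u0.
      by field; rewrite gt_eqF//; lra.
    rewrite ltr_pXn2r// ?nnegrE ?normc_ge0// exprn_ge0// ltW//.
    by case/andP: q01.
  apply: le_trans (Nlift _ _) _; first exact: measurableU.
  apply: le_trans (measureU2 P (mSlt _) mV) _.
  apply: le_trans (leeD (Sub m q q01) PV) _.
  rewrite -EFinD lee_fin qm -/x mulrDl lerD2l -mulrA ler_wpM2l// ler_wpM2l//.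
  (* The tail term 1 / p is dominated by p^(-m/(m+2)), as m <= m + 2. *)
  rewrite ler_expR lerN2 ler_piMl ?(ltW xp)// ler_pdivrMr// mul1r ler_nat.
  by rewrite -addn2 leq_addr.
Unshelve. all: by end_near.
Qed.
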